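(* A hesitant fuzzy soft mapping $f:\overline{(U,E)}\to\overline{(V,E')}$ is invertible if and only if there exists a hesitant fuzzy soft inverse mapping $f^{-1}:\overline{(V,E')}\to\overline{(U,E)}$ such that $f^{-1}\circ f=i_{\overline{(U,E)}}$ and $f\circ f^{-1}=i_{\overline{(V,E')}}$, where $i_{\overline{(U,E)}}$ and $i_{\overline{(V,E')}}$ are the hesitant fuzzy soft identity mappings on $\overline{(U,E)}$ and $\overline{(V,E')}$, respectively.
   Context: $U,V$ are universes and $E,E'$ are sets of attributes (parameters). A hesitant fuzzy element (HFE) is a set of some values in $[0,1]$. A hesitant fuzzy set on $U$ assigns an HFE to each element of $U$. A hesitant fuzzy soft set $F_A$ over $U$ with attributes from $E$, where $A\subseteq E$, assigns to each $e\in A$ a hesitant fuzzy set on $U$; write $F_A(e)(x)$ for the HFE of $x\in U$ at $e$, with $F_A(e)(x)=\{0\}$ for $e\in E\setminus A$. The hesitant fuzzy soft class $\overline{(U,E)}$ is the collection of all hesitant fuzzy soft sets over $U$ with attributes from $E$; $\overline{(V,E')}$ is defined likewise. The union of two HFEs is $\mu_1\cup\mu_2=\bigcup_{\gamma_1\in\mu_1,\gamma_2\in\mu_2}\max\{\gamma_1,\gamma_2\}$, that is, the set of all values $\max\{\gamma_1,\gamma_2\}$ with $\gamma_1\in\mu_1$, $\gamma_2\in\mu_2$. Given mappings $p:U\to V$ and $q:E\to E'$, the hesitant fuzzy soft mapping $f=(p,q):\overline{(U,E)}\to\overline{(V,E')}$ sends $F_A$ to its hesitant fuzzy soft image $f(F_A)$,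 defined for $\beta\in q(E)\subseteq E'$ and $y\in V$ by $f(F_A)(\beta)(y)=\bigcup_{\alpha\in q^{-1}(\beta)\cap A,\ s\in p^{-1}(y)}F_A(\alpha)(s)$, the union being that of HFEs; the value is $\{0\}$ where there is no such pair $(\alpha,s)$. The mapping $f=(p,q)$ is one-one if both $p$ and $q$ are one-one, and onto if both $p$ and $q$ are onto. A one-one onto hesitant fuzzy soft mapping $f=(p,q):\overline{(U,E)}\to\overline{(V,E')}$ is called invertible. Its hesitant fuzzy soft inverse mapping is denoted by $f^{-1}=(p^{-1},q^{-1}):\overline{(V,E')}\to\overline{(U,E)}$; it satisfies $f^{-1}(G_B)=F_A$ whenever $f(F_A)=G_B$, for $F_A\in\overline{(U,E)}$ and $G_B\in\overline{(V,E')}$. The composite $g\circ f$ of two hesitant fuzzy soft mappings, where the domain of $g$ is the co-domain of $f$, is the hesitant fuzzy soft mapping with $(g\circ f)(F_A)=g(f(F_A))$ for every $F_A$ in the domain of $f$. A hesitant fuzzy soft mapping $i=(p,q):\overline{(U,E)}\to\overline{(U,E)}$ is a hesitant fuzzy soft identity mapping if both $p:U\to U$ and $q:E\to E$ are identity mappings.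
   Formalization: The attribute set E is assumed nonempty; for E = E' = ∅ each soft class has a single element, so both identities hold even when p is not one-one (e.g. U two points, V one point) and the claim fails. *)

(* Defs.v *)
From HB Require Import structures.
From mathcomp Require Import all_boot all_order all_algebra.
From mathcomp Require Import boolp classical_sets functions reals.
From mathcomp Require Import interval_inference.

Set Implicit Arguments.
Unset Strict Implicit.
Unset Printing Implicit Defensive.

Import Order.TTheory GRing.Theory Num.Theory.
Local Open Scope classical_set_scope.
Local Open Scope ring_scope.

(* [{i01 R}] is the interval [0, 1] of R as a type. *)
Definition hfe (R : realType) : Type := set {i01 R}.

Definition hfe0 (R : realType) : hfe R := [set 0%:i01].
Arguments hfe0 R : clear implicits.

Definition hfe_union (R : realType) (mu1 mu2 : hfe R) : hfe R :=
  [set Num.max g1 g2 | g1 in mu1 & g2 in mu2].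

(* Union of a family of HFEs, possibly infinite: one value is chosen in each
   member of the family, and the maximum of the chosen values is replaced by
   their supremum. The two agree on finite families; see [hfe_bigunion_pair]
   for two members. Since [sup set0 = 0], the union of the empty family
   is {0}. *)
Definition hfe_bigunion (R : realType) (I : Type) (D : set I)
    (mu : I -> hfe R) : hfe R :=
  [set z | exists2 c : I -> {i01 R},
     (forall i, D i -> mu i (c i)) &
     z%:num = sup [set (c i)%:num | i in D]].

Lemma hfe_bigunion_set0 (R : realType) (I : Type) (mu : I -> hfe R) :
  hfe_bigunion set0 mu = hfe0 R.
Proof.
apply/seteqP; split => [z [c _]|z ->].
  by rewrite image_set0 sup0 => z0; apply/val_inj.
by exists (fun=> 0%:i01) => //; rewrite image_set0 sup0.
Qed.

Lemma hfe_bigunion_set1 (R : realType) (I : Type) (i : I) (mu : I -> hfe R) :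
  hfe_bigunion [set i] mu = mu i.
Proof.
apply/seteqP; split => [z [c muc]|z muz].
  by rewrite image_set1 sup1 => /val_inj ->; exact: muc.
by exists (fun=> z) => [j ->|] //; rewrite image_set1 sup1.
Qed.

Lemma hfe_bigunion_pair (R : realType) (mu : bool -> hfe R) :
  hfe_bigunion setT mu = hfe_union (mu true) (mu false).
Proof.
have supE (c : bool -> {i01 R}) : sup [set (c i)%:num | i in [set: bool]] =
    (Num.max (c true) (c false) : {i01 R})%:num.
  have -> : (Num.max (c true) (c false) : {i01 R})%:num =
      Num.max (c true)%:num (c false)%:num.
    by rewrite /Num.max /Order.max; case: ifP => h; case: ifP => // h';
      move: h h'; rewrite -num_lt => ->.
  have ub : ubound [set (c i)%:num | i in [set: bool]]
      (Num.max (c true)%:num (c false)%:num).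
    by move=> _ [[] _ <-]; rewrite le_max lexx ?orbT.
  apply/eqP; rewrite eq_le; apply/andP; split.
    by apply: ge_sup => //; exists (c true)%:num, true.
  by rewrite ge_max; apply/andP; split; apply: ub_le_sup;
    [exists (Num.max (c true)%:num (c false)%:num)|exists true|
     exists (Num.max (c true)%:num (c false)%:num)|exists false].
apply/seteqP; split => [z [c muc]|_ [a mua [b mub <-]]].
  rewrite supE => /val_inj ->.
  by exists (c true); [exact: muc|exists (c false); [exact: muc|]].
by exists (fun i => if i then a else b); [case|rewrite supE].
Qed.

(* The soft set F_A, with A = [hfss_dom] and F = [hfss_val]. Its values outside
   A are set to {0}, so that two soft sets are equal exactly when they have the
   same A and the same values on A. *)
Record hfss (R : realType) (U E : Type) := HFSS {
  hfss_dom : set E ;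
  hfss_val : E -> U -> hfe R ;
  hfss_out : forall e x, ~ hfss_dom e -> hfss_val e x = hfe0 R }.

Lemma hfss_eq (R : realType) (U E : Type) (F G : hfss R U E) :
  hfss_dom F = hfss_dom G ->
  (forall e x, hfss_dom F e -> hfss_val F e x = hfss_val G e x) -> F = G.
Proof.
case: F G => [A F HF] [B G HG] /= AB FG; subst B.
have FGE : F = G.
  apply/funext => e; apply/funext => x.
  by have [Ae|nAe] := pselect (A e); [exact: FG|rewrite HF// HG].
by subst G; congr HFSS; exact: Prop_irrelevance.
Qed.

Record hfs_mapping (U V E E' : Type) := HFSMapping {
  hfs_p : U -> V ;
  hfs_q : E -> E' }.

Definition hfs_image_val (R : realType) (U V E E' : Type)
    (f : hfs_mapping U V E E') (F : hfss R U E) (b : E') (y : V) : hfe R :=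
  hfe_bigunion
    [set i : E * U | [/\ hfs_q f i.1 = b, hfss_dom F i.1 & hfs_p f i.2 = y]]
    (fun i => hfss_val F i.1 i.2).

Lemma hfs_image_out (R : realType) (U V E E' : Type)
    (f : hfs_mapping U V E E') (F : hfss R U E) (b : E') (y : V) :
  ~ (hfs_q f @` hfss_dom F) b -> hfs_image_val f F b y = hfe0 R.
Proof.
move=> nb; rewrite /hfs_image_val (_ : mkset _ = set0) ?hfe_bigunion_set0//.
by rewrite -subset0 => -[e x] /= [qe Fe _]; apply: nb; exists e.
Qed.

(* The parameter set of f(F_A) is q(A): on the rest of q(E) the union defining
   the image is empty, so its value is {0}, as outside any parameter set. *)
Definition hfs_image (R : realType) (U V E E' : Type)
    (f : hfs_mapping U V E E') (F : hfss R U E) : hfss R V E' :=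
  HFSS (hfs_image_out (f := f) (F := F)).

Arguments hfs_image R {U V E E'} f F.

Definition hfs_one_one (U V E E' : Type) (f : hfs_mapping U V E E') : Prop :=
  injective (hfs_p f) /\ injective (hfs_q f).

Definition hfs_onto (U V E E' : Type) (f : hfs_mapping U V E E') : Prop :=
  range (hfs_p f) = setT /\ range (hfs_q f) = setT.

Definition hfs_invertible (U V E E' : Type) (f : hfs_mapping U V E E') : Prop :=
  hfs_one_one f /\ hfs_onto f.

Definition hfs_id (U E : Type) : hfs_mapping U U E E :=
  HFSMapping (fun x => x) (fun e => e).

Definition hfs_inverse (R : realType) (U V E E' : Type)
    (f : hfs_mapping U V E E') (g : hfs_mapping V U E' E) : Prop :=
  forall (F : hfss R U E) (G : hfss R V E'),
    hfs_image R f F = G -> hfs_image R g G = F.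

(* Main.v *)
Require Import Defs.
From mathcomp Require Import all_boot all_order all_algebra.
From mathcomp Require Import boolp classical_sets functions reals.
From mathcomp Require Import interval_inference.

(** Along an injective mapping the union defining the image has at most one
    member, so the image merely relabels parameters and points
    ([hfs_image_val_inj]). Relabelling by a bijection and then by its inverse
    changes nothing ([hfs_image_cancel]), which gives the direct implication.

    Conversely, suppose that taking the image by [f] and then by [g] fixes every
    soft set. Comparing the parameter sets for the soft set with the single
    parameter [e] shows that the parameter map of [g] undoes that of [f]. For
    the point maps, take the soft set [hfss_point e x], whose only value other
    than {0} is {1}, at [(e, x)]. Images create no values other than {0}
    ([hfs_image_support]), so the value {1} found at [x] in the double image
    must have travelled from [x] through [f] to some [y], and from [y] through
    [g] back to [x]; hence the point map of [g] undoes that of [f]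
    ([hfs_image_cancel_inv]). Such a soft set exists only if there is a
    parameter, whence the inhabitance hypothesis. Applied to both composites,
    this makes both component maps of [f] bijective. *)

Set Implicit Arguments.
Unset Strict Implicit.
Unset Printing Implicit Defensive.

Import Order.TTheory GRing.Theory Num.Theory.
Local Open Scope classical_set_scope.
Local Open Scope ring_scope.

(** The empty family is allowed: its supremum is 0 as well. *)
Lemma hfe_bigunion_hfe0 (R : realType) (I : Type) (D : set I)
    (mu : I -> hfe R) :
  (forall i, D i -> mu i = hfe0 R) -> hfe_bigunion D mu = hfe0 R.
Proof.
move=> mu0.
have sup_eq0 (c : I -> {i01 R}) : (forall i, D i -> mu i (c i)) ->
    sup [set (c i)%:num | i in D] = 0.
  move=> muc; have [->|/set0P[i Di]] := eqVneq D set0.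
    by rewrite image_set0 sup0.
  rewrite (_ : image _ _ = [set 0]) ?sup1//; apply/seteqP; split.
    by move=> _ [j Dj <-]; move: (muc j Dj); rewrite mu0// => ->.
  by move=> _ ->; exists i => //; move: (muc i Di); rewrite mu0// => ->.
apply/seteqP; split => [z [c muc]|_ ->].
  by rewrite sup_eq0// => z0; apply/val_inj.
have mu00 i : D i -> mu i 0%:i01 by move=> /mu0 ->.
by exists (fun=> 0%:i01) => //; rewrite sup_eq0.
Qed.

(** An image may merge several points into one, and its values may be suprema of
    others, but a value other than {0} has some nonzero source. *)
Lemma hfs_image_support (R : realType) (U V E E' : Type)
    (f : hfs_mapping U V E E') (F : hfss R U E) (b : E') (y : V) :
  hfss_val (hfs_image R f F) b y <> hfe0 R ->
  exists e x, [/\ hfs_q f e = b, hfs_p f x = y & hfss_val F e x <> hfe0 R].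
Proof.
move=> image_neq0; apply: contrapT => none; apply: image_neq0.
apply: hfe_bigunion_hfe0 => -[e x] /= [qe _ px].
by apply: contrapT => Fex; apply: none; exists e, x.
Qed.

Lemma hfs_image_val_inj (R : realType) (U V E E' : Type)
    (f : hfs_mapping U V E E') (F : hfss R U E) (e : E) (x : U) :
  hfs_one_one f -> hfss_dom F e ->
  hfss_val (hfs_image R f F) (hfs_q f e) (hfs_p f x) = hfss_val F e x.
Proof.
move=> [p_inj q_inj] Fe; rewrite /= /hfs_image_val.
rewrite (_ : mkset _ = [set (e, x)]) ?hfe_bigunion_set1//.
apply/seteqP; split => [[e' x'] /= [/q_inj -> _ /p_inj ->]//|_ ->].
by split.
Qed.

Lemma hfs_image_id (R : realType) (U E : Type) (F : hfss R U E) :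
  hfs_image R (hfs_id U E) F = F.
Proof.
have domE : hfss_dom (hfs_image R (hfs_id U E) F) = hfss_dom F.
  by rewrite /= image_id.
apply: hfss_eq => // e x; rewrite domE => Fe.
by apply: (hfs_image_val_inj (f := hfs_id U E)) => //; split=> ? ?.
Qed.

(** Injectivity of [g] leaves a single term in the union defining the value of
    the second image at [(e, x)]; by cancellation its index is the image of
    [(e, x)] under [f]. *)
Lemma hfs_image_cancel (R : realType) (U V E E' : Type)
    (f : hfs_mapping U V E E') (g : hfs_mapping V U E' E) (F : hfss R U E) :
  cancel (hfs_p f) (hfs_p g) -> cancel (hfs_q f) (hfs_q g) ->
  hfs_one_one g -> hfs_image R g (hfs_image R f F) = F.
Proof.
move=> pK qK g_inj.
have domE : hfss_dom (hfs_image R g (hfs_image R f F)) = hfss_dom F.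
  rewrite /= image_comp (_ : hfs_q g \o hfs_q f = id) ?image_id//.
  exact/funext.
apply: hfss_eq => // e x; rewrite domE => Fe.
rewrite -[in LHS](qK e) -[in LHS](pK x) hfs_image_val_inj//; last by exists e.
by apply: hfs_image_val_inj => //; split; [exact: can_inj pK|exact: can_inj qK].
Qed.

Definition hfss_zero (R : realType) (U E : Type) (A : set E) : hfss R U E :=
  @HFSS R U E A (fun _ _ => hfe0 R) (fun _ _ _ => erefl).

Definition hfss_point_val (R : realType) (U E : Type) (e : E) (x : U)
    (e' : E) (x' : U) : hfe R :=
  if `[< e' = e /\ x' = x >] then [set 1%:i01] else hfe0 R.
Arguments hfss_point_val R {U E} e x e' x'.

Lemma hfss_point_out (R : realType) (U E : Type) (e : E) (x : U) e' x' :
  ~ [set e] e' -> hfss_point_val R e x e' x' = hfe0 R.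
Proof. by move=> ne; rewrite /hfss_point_val asboolF// => -[]. Qed.

Definition hfss_point (R : realType) (U E : Type) (e : E) (x : U) :
    hfss R U E :=
  HFSS (@hfss_point_out R U E e x).

Lemma hfss_point_support (R : realType) (U E : Type) (e : E) (x : U)
    (e' : E) (x' : U) :
  hfss_val (hfss_point R e x) e' x' <> hfe0 R <-> e' = e /\ x' = x.
Proof.
rewrite /= /hfss_point_val; split; first by case: asboolP.
move=> ex'; rewrite asboolT// => E10.
have : hfe0 R 1%:i01 by rewrite -E10.
by move=> /(congr1 (fun z : {i01 R} => z%:num)) /= /eqP; rewrite oner_eq0.
Qed.

(** A soft set without nonzero values, such as [hfss_zero], already detects the
    parameter maps through its parameter set; this part holds when [U] is empty.
    The point maps are detected by tracing the one nonzero value of [hfss_point]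
    backwards through the two images. *)
Lemma hfs_image_cancel_inv (R : realType) (U V E E' : Type)
    (f : hfs_mapping U V E E') (g : hfs_mapping V U E' E) :
  inhabited E ->
  hfs_image R g \o hfs_image R f = hfs_image R (hfs_id U E) ->
  cancel (hfs_p f) (hfs_p g) /\ cancel (hfs_q f) (hfs_q g).
Proof.
move=> [e0] gf_id.
have gfE F : hfs_image R g (hfs_image R f F) = F.
  by rewrite -[RHS]hfs_image_id -gf_id.
split=> [x|e].
- have x_neq0 : hfss_val (hfs_image R g (hfs_image R f (hfss_point R e0 x)))
      e0 x <> hfe0 R by rewrite gfE; apply/hfss_point_support.
  have [b [y [_ gy fy_neq0]]] := hfs_image_support x_neq0.
  have [e [x' [_ fx' /hfss_point_support[_ x'E]]]] := hfs_image_support fy_neq0.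
  by rewrite -[in LHS]x'E fx'.
- have /(congr1 (@hfss_dom _ _ _)) /= := gfE (hfss_zero R U [set e]).
  by rewrite !image_set1 => /seteqP[/(_ _ erefl)].
Qed.

Lemma injective_onto_inverse (A B : Type) (h : A -> B) :
  injective h -> range h = setT -> exists k, cancel h k /\ cancel k h.
Proof.
move=> h_inj h_onto.
have /choice[k hk] (b : B) : exists a, h a = b.
  have : range h b by rewrite h_onto.
  by case=> a _; exists a.
by exists k; split => // a; apply: h_inj; rewrite hk.
Qed.

Lemma cancel_onto (A B : Type) (h : A -> B) (k : B -> A) :
  cancel k h -> range h = setT.
Proof. by move=> kK; apply/seteqP; split => // b _; exists (k b). Qed.

Theorem theorem3p23 (R : realType) (U V E E' : Type) (hE : inhabited E)
    (f : hfs_mapping U V E E') :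
  hfs_invertible f <->
  exists g : hfs_mapping V U E' E,
    [/\ hfs_inverse R f g,
        hfs_image R g \o hfs_image R f = hfs_image R (hfs_id U E) &
        hfs_image R f \o hfs_image R g = hfs_image R (hfs_id V E')].
Proof.
split=> [[[p_inj q_inj] [p_onto q_onto]]|[g [_ gf_id fg_id]]].
- have [p' [pK p'K]] := injective_onto_inverse p_inj p_onto.
  have [q' [qK q'K]] := injective_onto_inverse q_inj q_onto.
  have g_inj : hfs_one_one (HFSMapping p' q').
    by split; [exact: can_inj p'K|exact: can_inj q'K].
  exists (HFSMapping p' q'); split.
  + by move=> F _ <-; exact: hfs_image_cancel.
  + by apply/funext => F; rewrite hfs_image_id; exact: hfs_image_cancel.
  + by apply/funext => G; rewrite hfs_image_id; exact: hfs_image_cancel.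
- have hE' : inhabited E' by case: hE => e; exact: inhabits (hfs_q f e).
  have [pK qK] := hfs_image_cancel_inv hE gf_id.
  have [p'K q'K] := hfs_image_cancel_inv hE' fg_id.
  split; split; [exact: can_inj pK|exact: can_inj qK|
    exact: cancel_onto p'K|exact: cancel_onto q'K].
Qed.
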